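(* Let $A=[a_{ij}]_{i,j\in I}$ be the Cartan matrix of a finite-dimensional complex simple Lie algebra, let $\chi$ be a $(\pi,A)$-admissible bicharacter on $V_{\mathbb Z}$, and let $U=U(\chi,\pi)$. Let $\mathbb A$ and $U^0_{\mathbb A}$ be as in the context. Then the elements $$\prod_{i\in I}K_{\pi(i)}^{x_i}\,(K_{\pi(i)}L_{\pi(i)})^{y_i}\left[\begin{array}{c}K_{\pi(i)},L_{\pi(i)},0\\ z_i\end{array}\right]_{q_{ii}}\qquad (x_i\in\{0,1\},\ y_i\in\mathbb Z,\ z_i\in\mathbb Z_{\ge0})$$ form an $\mathbb A$-basis of $U^0_{\mathbb A}$.
   Context: **Notation.** $\mathbb K$ is a field of characteristic zero, $\mathbb K^\times=\mathbb K\setminus\{0\}$, $\mathbb N=\{1,2,\ldots\}$. Let $\theta\in\mathbb N$, $I=\{1,\ldots,\theta\}$, and let $V_{\mathbb Z}$ be a free abelian group of rank $\theta$. A bicharacter is a map $\chi:V_{\mathbb Z}\times V_{\mathbb Z}\to\mathbb K^\times$ with $\chi(x+y,z)=\chi(x,z)\chi(y,z)$ and $\chi(x,y+z)=\chi(x,y)\chi(x,z)$. Throughout $\pi:I\to V_{\mathbb Z}$ is a map such that $\pi(I)$ is a $\mathbb Z$-basis of $V_{\mathbb Z}$, and $q_{ij}=\chi(\pi(i),\pi(j))$. **Generalized quantum group.** $U=U(\chi,\pi)$ is the unique associative unital $\mathbb K$-algebra such that: (i) it is generated by $K_\lambda,L_\lambda$ ($\lambda\in V_{\mathbb Z}$),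 $E_i,F_i$ ($i\in I$); (ii) $K_0=L_0=1$, $K_\lambda K_\mu=K_{\lambda+\mu}$, $L_\lambda L_\mu=L_{\lambda+\mu}$, $K_\lambda L_\mu=L_\mu K_\lambda$, $K_{\pi(i)}E_jK_{\pi(i)}^{-1}=q_{ij}E_j$, $K_{\pi(i)}F_jK_{\pi(i)}^{-1}=q_{ij}^{-1}F_j$, $L_{\pi(i)}E_jL_{\pi(i)}^{-1}=q_{ji}^{-1}E_j$, $L_{\pi(i)}F_jL_{\pi(i)}^{-1}=q_{ji}F_j$, $[E_i,F_j]=\delta_{ij}(-K_{\pi(i)}+L_{\pi(i)})$; (iii) there is a grading $U=\oplus_{\lambda\in V_{\mathbb Z}}U_\lambda$, $U_\lambda U_\mu\subset U_{\lambda+\mu}$, with $K_{\pi(i)}^{\pm1},L_{\pi(i)}^{\pm1}\in U_0$, $E_i\in U_{\pi(i)}$, $F_i\in U_{-\pi(i)}$; (iv) with $U^0$, $U^+$, $U^-$ the subalgebras generated by the $K_\lambda L_\mu$, the $E_i$, the $F_i$ respectively, the elements $K_\lambda L_\mu$ ($\lambda,\mu\in V_{\mathbb Z}$) form a $\mathbb K$-basis of $U^0$, and multiplication $U^+\otimes U^0\otimes U^-\to U$ is a linear isomorphism; (v) there is no non-scalar $X\in U^+$ with $[X,F_i]=0$ for all $i\in I$, and no non-scalar $Y\in U^-$ with $[E_i,Y]=0$ for all $i\in I$. **Admissible bicharacter.** Let $A=[a_{ij}]_{i,j\in I}$ be a symmetrizable generalized Cartan matrix, $d_i\in\mathbb N$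 with $d_ia_{ij}=d_ja_{ji}$. Let $\dot q\in\mathbb K^\times$ with $\dot q^r\neq1$ for all $r\in\mathbb N$. Let $\sqrt\chi:V_{\mathbb Z}\times V_{\mathbb Z}\to\mathbb K^\times$ be a bicharacter and $\dot q_{ij}=\sqrt\chi(\pi(i),\pi(j))$. Assume $\dot q_{ii}=\dot q^{2d_i}$, $\dot q_{ij}\dot q_{ji}=\dot q^{2d_ia_{ij}}$, $q_{ij}=\dot q_{ij}^2$ for all $i,j$, and that for every $k\in I$ there is $\Theta(q_{kk}-1)\in\mathbb K^\times$ with $\Theta(q_{kk}-1)^2=q_{kk}-1$. Then $\chi$ is called $(\pi,A)$-admissible; these data are fixed. **$\mathbb A$-form of $U^0$.** $\mathbb A$ is the $\mathbb Z$-subalgebra of $\mathbb K$ generated by $\dot q_{ij}^{\pm1}$ ($i,j\in I$). For $x\in\mathbb K^\times$ with $x^b\ne1$ for all $b\in\mathbb N$, $X,Y\in U^0$, $l\in\mathbb Z$, $p\in\mathbb Z_{\ge0}$, put $$\left[\begin{array}{c}X,Y,l\\ p\end{array}\right]_x=\prod_{t=1}^p\frac{x^{l-t+1}X-Y}{x^t-1}.$$ $U^0_{\mathbb A}$ is the $\mathbb A$-subalgebra of $U^0$ generated by $K_\lambda L_\mu$ ($\lambda,\mu\in V_{\mathbb Z}$) and $\left[\begin{array}{c}K_{\pi(i)},L_{\pi(i)},l\\ p\end{array}\right]_{q_{ii}}$ ($i\in I$, $l\in\mathbb Z$, $p\in\mathbb Z_{\ge0}$). *)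

(* Defs.v *)
From HB Require Import structures.
From mathcomp Require Import all_boot all_order all_algebra.
From mathcomp Require Import boolp classical_sets reals complex.

Set Implicit Arguments.
Unset Strict Implicit.
Unset Printing Implicit Defensive.

Import Order.TTheory GRing.Theory Num.Theory.

Local Open Scope classical_set_scope.
Local Open Scope ring_scope.

(** * Generated subrings and subalgebras, bases of subsets *)

Definition subring_gen (k : nzRingType) (G : set k) : set k :=
  smallest (fun S : set k => subring_closed [in S]) G.

(* [scalars] is meant to be a subring of [k]. *)
Definition subalg_over (k : nzRingType) (U : algType k) (scalars : set k)
    (S : set U) : Prop :=
  [/\ S 1,
      forall a u v, scalars a -> S u -> S v -> S (a *: u + v) &
      forall u v, S u -> S v -> S (u * v)].

Definition subalg_gen (k : nzRingType) (U : algType k) (scalars : set k)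
    (G : set U) : set U :=
  smallest (subalg_over scalars) G.

Definition span_over (k : nzRingType) (U : lmodType k) (scalars : set k)
    (J : eqType) (b : J -> U) : set U :=
  [set u | exists (s : seq J) (c : J -> k),
     (forall j, scalars (c j)) /\ u = \sum_(j <- s) c j *: b j].

Definition free_over (k : nzRingType) (U : lmodType k) (scalars : set k)
    (J : eqType) (b : J -> U) : Prop :=
  forall (s : seq J) (c : J -> k), uniq s -> (forall j, scalars (c j)) ->
    \sum_(j <- s) c j *: b j = 0 -> forall j, j \in s -> c j = 0.

Definition basis_over (k : nzRingType) (U : lmodType k) (scalars : set k)
    (M : set U) (J : eqType) (b : J -> U) : Prop :=
  M = span_over scalars b /\ free_over scalars b.

(* As [pi] is indexed by ['I_theta], this also says that [V] is free abelian
   of rank [theta]. *)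
Definition is_Zbasis (V : zmodType) (theta : nat) (pi : 'I_theta -> V) : Prop :=
  forall v, exists! c : {ffun 'I_theta -> int}, v = \sum_i pi i *~ c i.

(** * Cartan matrices of simple Lie algebras *)

Section LieAlgebra.
Variables (C : fieldType) (g : vectType C) (br : g -> g -> g).

Definition is_lie_bracket : Prop :=
  [/\ forall x, linear (br x), forall y, linear (br^~ y),
      forall x, br x x = 0 &
      forall x y z, br x (br y z) + br y (br z x) + br z (br x y) = 0].

Definition is_lie_simple : Prop :=
  (exists x y, br x y != 0) /\
  (forall J : {vspace g}, (forall x y, y \in J -> br x y \in J) ->
     J = 0%VS \/ J = fullv).

(* A nilpotent, self-normalizing subalgebra. The iterated brackets
   [x1, [x2, .. [xn, y]]] span the n-th term of the lower central series. *)
Definition is_cartan_subalgebra (h : {vspace g}) : Prop :=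
  [/\ forall x y, x \in h -> y \in h -> br x y \in h,
      exists n, forall (s : seq g) (y : g), size s = n ->
        {subset s <= h} -> y \in h -> foldr br y s = 0 &
      forall x, (forall y, y \in h -> br x y \in h) -> x \in h].

Variable h : {vspace g}.

Local Notation dual := 'Hom(subvs_of h, C^o).

Definition root_space (alpha : dual) : set g :=
  [set x | forall t : subvs_of h, br (vsval t) x = (alpha t : C) *: x].

Definition is_root (alpha : dual) : Prop :=
  alpha != 0 /\ exists2 x, x != 0 & root_space alpha x.

Definition is_root_base (theta : nat) (alpha : 'I_theta -> dual) : Prop :=
  [/\ basis_of fullv (codom alpha),
      forall i, is_root (alpha i) &
      forall beta, is_root beta -> exists n : 'I_theta -> nat,
        beta = \sum_i alpha i *+ n i \/ beta = - \sum_i alpha i *+ n i].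

(* [t] is the coroot of [alpha]. *)
Definition is_coroot (alpha : dual) (t : subvs_of h) : Prop :=
  (exists e f, [/\ root_space alpha e, root_space (- alpha) f &
                   vsval t = br e f]) /\
  alpha t = 2%:R.

End LieAlgebra.

(* Convention: a_ij = <alpha_j, alpha_i^vee>, i.e. 2 (alpha_i, alpha_j) /
   (alpha_i, alpha_i). *)
Definition simple_lie_cartan_matrix (C : fieldType) (theta : nat)
    (A : 'M[int]_theta) : Prop :=
  exists (g : vectType C) (br : g -> g -> g) (h : {vspace g})
         (alpha : 'I_theta -> 'Hom(subvs_of h, C^o))
         (coroot : 'I_theta -> subvs_of h),
    [/\ is_lie_bracket br, is_lie_simple br, is_cartan_subalgebra br h,
        is_root_base br alpha &
        forall i, is_coroot br (alpha i) (coroot i) /\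
          forall j, alpha j (coroot i) = (A i j)%:~R].

(** * Bicharacters *)

Definition bicharacter (k : fieldType) (V : zmodType) (chi : V -> V -> k) :
    Prop :=
  [/\ forall x y, chi x y != 0,
      forall x y z, chi (x + y) z = chi x z * chi y z &
      forall x y z, chi x (y + z) = chi x y * chi x z].

Definition symmetrizable_gcm (theta : nat) (A : 'M[int]_theta)
    (d : 'I_theta -> nat) : Prop :=
  [/\ forall i, A i i = 2,
      forall i j, i != j -> A i j <= 0,
      forall i j, A i j = 0 -> A j i = 0,
      forall i, (0 < d i)%N &
      forall i j, (d i)%:Z * A i j = (d j)%:Z * A j i].

Record admissible (k : fieldType) (V : zmodType) (theta : nat)
    (pi : 'I_theta -> V) (A : 'M[int]_theta) (d : 'I_theta -> nat) (qdot : k)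
    (sqrtchi chi : V -> V -> k) : Prop := Admissible {
  adm_gcm : symmetrizable_gcm A d;
  adm_qdot_neq0 : qdot != 0;
  adm_qdot_nonroot : forall r : nat, (0 < r)%N -> qdot ^+ r != 1;
  adm_sqrtchi : bicharacter sqrtchi;
  adm_chi : bicharacter chi;
  adm_diag : forall i, sqrtchi (pi i) (pi i) = qdot ^+ (2 * d i);
  adm_offdiag : forall i j,
    sqrtchi (pi i) (pi j) * sqrtchi (pi j) (pi i)
    = qdot ^ (2 * (d i)%:Z * A i j);
  adm_square : forall i j, chi (pi i) (pi j) = sqrtchi (pi i) (pi j) ^+ 2;
  adm_Theta : forall i, exists2 r : k, r != 0 & r ^+ 2 = chi (pi i) (pi i) - 1
}.

(** * The generalized quantum group *)

Definition is_grading (k : fieldType) (V : zmodType) (U : algType k)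
    (Gr : V -> set U) : Prop :=
  [/\ forall l, Gr l 0 /\
        (forall (a : k) u v, Gr l u -> Gr l v -> Gr l (a *: u + v)),
      forall u, exists (s : seq V) (f : V -> U),
        (forall l, Gr l (f l)) /\ u = \sum_(l <- s) f l,
      forall (s : seq V) (f : V -> U), uniq s -> (forall l, Gr l (f l)) ->
        \sum_(l <- s) f l = 0 -> forall l, l \in s -> f l = 0 &
      forall l m u v, Gr l u -> Gr m v -> Gr (l + m) (u * v)].

Definition trilinear_on (k : fieldType) (U W : lmodType k) (A B C : set U)
    (phi : U -> U -> U -> W) : Prop :=
  [/\ forall (a : k) x x' y z, A x -> A x' -> B y -> C z ->
        phi (a *: x + x') y z = a *: phi x y z + phi x' y z,
      forall (a : k) x y y' z, A x -> B y -> B y' -> C z ->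
        phi x (a *: y + y') z = a *: phi x y z + phi x y' z &
      forall (a : k) x y z z', A x -> B y -> C z -> C z' ->
        phi x y (a *: z + z') = a *: phi x y z + phi x y z'].

(* Multiplication A (x) B (x) C -> U is a linear isomorphism for subspaces
   A, B, C of U: since the tensor product of infinite-dimensional spaces is not
   available as a type, this says that U together with (x, y, z) |-> x * y * z
   satisfies the universal property defining A (x) B (x) C. *)
Definition mul_tensor_iso (k : fieldType) (U : algType k) (A B C : set U) :
    Prop :=
  forall (W : lmodType k) (phi : U -> U -> U -> W), trilinear_on A B C phi ->
    exists2 Phi : {linear U -> W},
      forall x y z, A x -> B y -> C z -> Phi (x * y * z) = phi x y z &
      forall Psi : {linear U -> W},
        (forall x y z, A x -> B y -> C z -> Psi (x * y * z) = phi x y z) ->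
        Psi =1 Phi.

Section GeneralizedQuantumGroup.
Variables (k : fieldType) (V : zmodType) (theta : nat) (pi : 'I_theta -> V).
Variable chi : V -> V -> k.
(* In a [unitRingType] the units are exactly the two-sided invertible elements,
   so (classically) every algebra carries such a structure; it only gives a
   meaning to the inverses and integer powers of the K's and L's. *)
Variables (U : unitAlgType k) (K L : V -> U) (E F : 'I_theta -> U).

Definition U_zero : set U :=
  subalg_gen setT [set u | exists l m, u = K l * L m].
Definition U_plus : set U := subalg_gen setT (range E).
Definition U_minus : set U := subalg_gen setT (range F).

Local Notation q i j := (chi (pi i) (pi j)).

Record is_gen_quantum_group : Prop := IsGenQuantumGroup {
  gqg_gen : subalg_gen setT (range K `|` range L `|` range E `|` range F)
            = [set: U];
  gqg_K0 : K 0 = 1;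
  gqg_L0 : L 0 = 1;
  gqg_KD : forall l m, K l * K m = K (l + m);
  gqg_LD : forall l m, L l * L m = L (l + m);
  gqg_KL : forall l m, K l * L m = L m * K l;
  gqg_KE : forall i j, K (pi i) * E j * (K (pi i))^-1 = q i j *: E j;
  gqg_KF : forall i j, K (pi i) * F j * (K (pi i))^-1 = (q i j)^-1 *: F j;
  gqg_LE : forall i j, L (pi i) * E j * (L (pi i))^-1 = (q j i)^-1 *: E j;
  gqg_LF : forall i j, L (pi i) * F j * (L (pi i))^-1 = q j i *: F j;
  gqg_EF : forall i j, E i * F j - F j * E i
             = if i == j then - K (pi i) + L (pi i) else 0;
  gqg_grading : exists Gr : V -> set U, is_grading Gr /\
    forall i, [/\ Gr 0 (K (pi i)) /\ Gr 0 (K (pi i))^-1,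
                  Gr 0 (L (pi i)) /\ Gr 0 (L (pi i))^-1,
                  Gr (pi i) (E i) & Gr (- pi i) (F i)];
  gqg_zero_basis :
    basis_over setT U_zero (fun lm : V * V => K lm.1 * L lm.2);
  gqg_triangular : mul_tensor_iso U_plus U_zero U_minus;
  gqg_plus : forall X, U_plus X -> (forall i, X * F i - F i * X = 0) ->
    exists c : k, X = c%:A;
  gqg_minus : forall Y, U_minus Y -> (forall i, E i * Y - Y * E i = 0) ->
    exists c : k, Y = c%:A
}.

End GeneralizedQuantumGroup.

(** * The integral form of [U_zero] *)

Definition ground_form (k : fieldType) (V : zmodType) (theta : nat)
    (pi : 'I_theta -> V) (sqrtchi : V -> V -> k) : set k :=
  subring_gen [set a | exists i j, a = sqrtchi (pi i) (pi j) \/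
                                   a = (sqrtchi (pi i) (pi j))^-1].

Definition qbracket (k : fieldType) (U : algType k) (x : k) (X Y : U)
    (l : int) (p : nat) : U :=
  \prod_(1 <= t < p.+1)
    ((x ^+ t - 1)^-1 *: (x ^ (l - t%:Z + 1) *: X - Y)).

Definition U_zero_form (k : fieldType) (V : zmodType) (theta : nat)
    (pi : 'I_theta -> V) (sqrtchi chi : V -> V -> k) (U : algType k)
    (K L : V -> U) : set U :=
  subalg_gen (ground_form pi sqrtchi)
    ([set u | exists l m, u = K l * L m] `|`
     [set u | exists i (l : int) (p : nat),
        u = qbracket (chi (pi i) (pi i)) (K (pi i)) (L (pi i)) l p]).

(* The index (x, y, z) consists of x_i in {0, 1} (as booleans), y_i in Z and
   z_i in Z_{>= 0}. *)
Definition zero_monomial (k : fieldType) (V : zmodType) (theta : nat)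
    (pi : 'I_theta -> V) (chi : V -> V -> k) (U : unitAlgType k)
    (K L : V -> U)
    (xyz : {ffun 'I_theta -> bool} * {ffun 'I_theta -> int} *
           {ffun 'I_theta -> nat}) : U :=
  let: (x, y, z) := xyz in
  \prod_i (K (pi i) ^+ x i * (K (pi i) * L (pi i)) ^ y i *
           qbracket (chi (pi i) (pi i)) (K (pi i)) (L (pi i)) 0 (z i)).

(* Main.v *)
Require Import Defs.
From HB Require Import structures.
From mathcomp Require Import all_boot all_order all_algebra.
From mathcomp Require Import boolp classical_sets reals complex.
From mathcomp Require Import ring zify.

(** Fix one simple root with diagonal parameter [q], write [K], [L] for the two
    corresponding group-like elements and put [T = K / L]. Everything in the
    integral form that involves only [K] and [L] is a combination of elements
    [L ^ n * T ^ m * P(T)], where [P] is a polynomial such that [P(q ^ j)] lies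
    in the ground ring for every integer [j]: the bracket with parameters
    [l], [p] is [L ^ p] times the q-binomial polynomial [gauss q l p] in [T],
    whose value at [q ^ j] is the Gaussian binomial with upper entry [l + j]
    and lower entry [p], an element of the ring generated by [q] and [1 / q]
    by q-Pascal. Such elements are visibly stable under products.

    The monomial [K ^ x * (K * L) ^ y * bracket z] is
    [L ^ (x + 2 y + z) * T ^ (x + y) * gauss q 0 z (T)]. In a fixed degree [n]
    in [K] and [L], the equation [n = x + 2 y + z] leaves exactly one monomial
    for each [z], and as [z] grows by one the interval of exponents of [T] in
    that monomial grows by one at one of its ends. So a given
    [L ^ n * T ^ m * P(T)] fits into the interval of a large enough [z], and
    Newton interpolation at the points [1, q, q ^ 2, ...] expands it: the
    polynomial [gauss q 0 z] vanishes at [q ^ j] for [0 <= j < z] and equals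
    [1] at [q ^ z], hence every coefficient is computed inside the ground ring
    ([newton_expansion], [laurent_expansion]). Taking products over the simple
    roots, the span of the monomials is a subalgebra that contains the
    generators ([U_zero_U_zero_form_eq_span]).

    For independence, elements are split by their degree in the [K]'s and
    [L]'s, which is legitimate because the products [K l * L m] are linearly
    independent, and each homogeneous part is evaluated at the character that
    sends the [T] of the [i]-th root to the [z i]-th power of its parameter. A
    monomial of the same degree with exponents [z'] survives only if
    [z' <= z] in every coordinate, so the system is triangular with nonzero
    diagonal ([homog_value_relation], [zero_monomial_free]). *)

Set Implicit Arguments.
Unset Strict Implicit.
Unset Printing Implicit Defensive.

Import Order.TTheory GRing.Theory Num.Theory.

Local Open Scope ring_scope.

(** * Spans with coefficients in a subring *)

Section FormalSums.
Variables (k : nzRingType) (J : eqType).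

(** The target [G] is arbitrary: the same regrouping is applied to the family
    of interest and to a scalar function of its indices. *)
Lemma formal_sum_collect (M : lmodType k) (G : J -> M) (r : seq (k * J)) :
  \sum_(t <- r) t.1 *: G t.2 =
  \sum_(j <- undup [seq t.2 | t <- r]) (\sum_(t <- r | t.2 == j) t.1) *: G j.
Proof.
under [RHS]eq_bigr do rewrite scaler_suml.
rewrite (exchange_big_dep predT) //= [LHS]big_seq [RHS]big_seq.
apply: eq_bigr => t rt.
rewrite (eq_bigl (pred1 t.2)) => [|j]; last by rewrite /= eq_sym.
by rewrite -big_filter filter_pred1_uniq ?big_seq1 ?undup_uniq ?mem_undup ?map_f.
Qed.

(** Lists of pairs may repeat an index with different coefficients, which makes
    sums and products of spans a matter of concatenation. *)
Lemma span_overP (M : lmodType k) (S : subringClosed k) (b : J -> M) (u : M) :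
  span_over [set` S] b u <->
  exists r : seq (k * J),
    (forall t, t \in r -> t.1 \in S) /\ u = \sum_(t <- r) t.1 *: b t.2.
Proof.
split=> [[s [c [Sc ->]]]|[r [Sr ->]]].
  exists [seq (c j, j) | j <- s]; split; last by rewrite big_map.
  by move=> _ /mapP[j _ ->]; apply: Sc.
exists (undup [seq t.2 | t <- r]), (fun j => \sum_(t <- r | t.2 == j) t.1).
split; last exact: formal_sum_collect.
by move=> j /=; rewrite big_seq_cond; apply: rpred_sum => t /andP[/Sr].
Qed.

Variables (M : lmodType k) (S : subringClosed k) (b : J -> M).

Lemma span_over_basis j : span_over [set` S] b (b j).
Proof.
by exists [:: j], (fun=> 1); split=> [i|]; rewrite /= ?rpred1 // big_seq1 scale1r.
Qed.

Lemma span_over0 : span_over [set` S] b 0.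
Proof. by exists [::], (fun=> 1); split=> [i|]; rewrite /= ?rpred1 ?big_nil. Qed.

Lemma span_over_linear a u v : a \in S ->
  span_over [set` S] b u -> span_over [set` S] b v ->
  span_over [set` S] b (a *: u + v).
Proof.
move=> Sa /span_overP[r [Sr ->]] /span_overP[r' [Sr' ->]]; apply/span_overP.
exists ([seq (a * t.1, t.2) | t <- r] ++ r'); split=> [t|].
  by rewrite mem_cat => /orP[/mapP[x /Sr Sx ->]|/Sr' //]; rewrite /= rpredM.
rewrite big_cat big_map scaler_sumr; congr (_ + _).
by apply: eq_bigr => t _; rewrite scalerA.
Qed.

Lemma span_over_sum (I : Type) (r : seq I) (P : pred I) (a : I -> k)
    (F : I -> M) :
  (forall i, P i -> a i \in S) ->
  (forall i, P i -> span_over [set` S] b (F i)) ->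
  span_over [set` S] b (\sum_(i <- r | P i) a i *: F i).
Proof.
move=> Sa bF; elim: r => [|i r IH]; first by rewrite big_nil; apply: span_over0.
by rewrite big_cons; case: ifP => // Pi; apply: span_over_linear; auto.
Qed.

End FormalSums.

(** A function on a free family extends to a linear form on its span; this says
    that the extension is well defined, without constructing it. *)
Lemma free_over_functional (k : fieldType) (J : eqType) (M : lmodType k)
    (b : J -> M) (phi : J -> k) (r : seq (k * J)) :
  free_over setT b -> \sum_(t <- r) t.1 *: b t.2 = 0 ->
  \sum_(t <- r) t.1 * phi t.2 = 0.
Proof.
move=> b_free; rewrite formal_sum_collect => r0.
rewrite (formal_sum_collect (phi : J -> k^o)) big_seq big1 // => j rj.
by rewrite (b_free _ _ (undup_uniq _) _ r0 j rj) ?scale0r.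
Qed.

(** * Gaussian binomials *)

Section Gauss.
Variables (k : fieldType) (q : k).

Definition qbin (m : int) (p : nat) : k :=
  \prod_(t < p) ((q ^ (m - t%:Z) - 1) / (q ^+ t.+1 - 1)).

(** The bracket of the integral form, divided by the right power of [L] and
    written as a polynomial in [T = K / L]. *)
Definition gauss (l : int) (p : nat) : {poly k} :=
  \prod_(t < p) ((q ^+ t.+1 - 1)^-1 *: (q ^ (l - t%:Z) *: 'X - 1)).

Hypothesis q_neq0 : q != 0.
Hypothesis q_nonroot : forall n : nat, (0 < n)%N -> q ^+ n != 1.

Lemma gauss_horner l p j : (gauss l p).[q ^ j] = qbin (l + j) p.
Proof.
rewrite horner_prod; apply: eq_bigr => t _.
by rewrite !hornerE -expfzDr // mulrC addrAC.
Qed.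

Lemma size_gauss l p : (size (gauss l p) <= p.+1)%N.
Proof.
rewrite /gauss; elim: p => [|p IH]; first by rewrite big_ord0 size_poly1.
rewrite big_ord_recr /=; apply: leq_trans (size_polyMleq _ _) _.
set f := (X in (_ + size X)%N); suff szf: (size f <= 2)%N.
  by rewrite -subn1 leq_subLR; apply: leq_trans (leq_add IH szf) _; lia.
apply: leq_trans (size_scale_leq _ _) _.
apply: leq_trans (size_polyD _ _) _; rewrite geq_max size_polyN size_poly1 andbT.
by apply: leq_trans (size_scale_leq _ _) _; rewrite size_polyX.
Qed.

Lemma q_power_sub1_neq0 n : q ^+ n.+1 - 1 != 0.
Proof. by rewrite subr_eq0 q_nonroot. Qed.

Lemma q_power_inj : injective (fun n : nat => q ^ n%:Z).
Proof.
suff H (m n : nat) : (m < n)%N -> q ^+ m <> q ^+ n.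
  by move=> m n /= e; case: (ltngtP m n) => // /H; [case/(_ e)|case/(_ (esym e))].
move=> lt_mn e; have /q_nonroot/eqP : (0 < n - m)%N by rewrite subn_gt0.
apply; apply: (mulfI (expf_neq0 m q_neq0)).
by rewrite -exprD mulr1 e; congr (_ ^+ _); lia.
Qed.

Lemma qbin0n p : qbin 0 p.+1 = 0.
Proof. by rewrite /qbin big_ord_recl /= subr0 expr0z subrr mul0r mul0r. Qed.

Lemma qbinSr m p :
  qbin m p.+1 = qbin m p * ((q ^ (m - p%:Z) - 1) / (q ^+ p.+1 - 1)).
Proof. exact: big_ord_recr. Qed.

Lemma qbinS m p :
  qbin (m + 1) p.+1 = qbin m p * ((q ^ (m + 1) - 1) / (q ^+ p.+1 - 1)).
Proof.
elim: p => [|p IH]; first by rewrite /qbin !big_ord1 big_ord0 mul1r subr0.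
rewrite qbinSr IH qbinSr -!mulrA; congr (_ * _).
have -> : m + 1 - p.+1%:Z = m - p%:Z by lia.
by rewrite mulrCA [RHS]mulrCA; congr (_ * _);
  rewrite mulrC -!mulrA; congr (_ * _); rewrite mulrC.
Qed.

(** This can be solved for [qbin m p.+1] as well, the coefficient being a power
    of [q]; hence it reaches negative [m] too. *)
Lemma qbin_pascal m p :
  qbin (m + 1) p.+1 = q ^+ p.+1 * qbin m p.+1 + qbin m p.
Proof.
have d0 := q_power_sub1_neq0 p.
rewrite qbinS qbinSr; have -> : m + 1 = p.+1%:Z + (m - p%:Z) by lia.
by rewrite expfzDr // exprnP; field.
Qed.

Lemma qbin_small (j z : nat) : (j < z)%N -> qbin j z = 0.
Proof.
move=> lt_jz; rewrite /qbin (bigD1 (Ordinal lt_jz)) //=.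
by rewrite subrr expr0z subrr mul0r mul0r.
Qed.

Lemma qbin_diag (z : nat) : qbin z z = 1.
Proof.
elim: z => [|z IH]; first exact: big_ord0.
have -> : z.+1%:Z = z%:Z + 1 by lia.
by rewrite qbin_pascal qbin_small // mulr0 add0r.
Qed.

Variable S : subringClosed k.
Hypotheses (Sq : q \in S) (SqV : q^-1 \in S).

Lemma q_power_in (n : int) : q ^ n \in S.
Proof.
by case: n => n; [apply: rpredX | rewrite NegzE -exprnN -exprVn; apply: rpredX].
Qed.

Lemma qbin_in m p : qbin m p \in S.
Proof.
elim: p m => [|p IH] m; first by rewrite /qbin big_ord0 rpred1.
elim: m => [|n IHn|n IHn]; first by rewrite qbin0n rpred0.
  by rewrite -addn1 PoszD qbin_pascal rpredD // rpredM // rpredX.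
have -> : qbin (- n.+1%:Z) p.+1 =
    q ^ (- p.+1%:Z) * (qbin (- n%:Z) p.+1 - qbin (- n.+1%:Z) p).
  have -> : - n%:Z = - n.+1%:Z + 1 by lia.
  rewrite qbin_pascal addrK mulrA exprnP -expfzDr //.
  by rewrite addNr expr0z mul1r.
by rewrite rpredM ?rpredB ?q_power_in.
Qed.

Definition int_valued (P : {poly k}) : Prop := forall j : int, P.[q ^ j] \in S.

Lemma int_valued1 : int_valued 1.
Proof. by move=> j; rewrite hornerC rpred1. Qed.

Lemma int_valuedM P Q : int_valued P -> int_valued Q -> int_valued (P * Q).
Proof. by move=> SP SQ j; rewrite hornerM rpredM. Qed.

Lemma int_valuedXn e : int_valued 'X^e.
Proof. by move=> j; rewrite hornerXn rpredX // q_power_in. Qed.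

Lemma int_valued_gauss l p : int_valued (gauss l p).
Proof. by move=> j; rewrite gauss_horner qbin_in. Qed.

(** Newton interpolation at the points [q ^ 0, q ^ 1, ...]. The freedom in [e]
    lets the powers of [T] be shifted to those of the monomials of a given
    degree. *)
Lemma newton_expansion (N : nat) (e : nat -> nat) (P : {poly k}) :
  int_valued P -> (size P <= N)%N ->
  (forall z, (z < N)%N -> (e z + z < N)%N) ->
  exists a : nat -> k, (forall z, a z \in S) /\
    P = \sum_(z < N) a z *: ('X^(e z) * gauss 0 z).
Proof.
move=> SP szP leN; set b := fun z : nat => 'X^(e z) * gauss 0 z.
have Sb z : int_valued (b z).
  exact: int_valuedM (int_valuedXn _) (int_valued_gauss _ _).
have Newton n : (n <= N)%N -> exists a : nat -> k, (forall z, a z \in S) /\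
      forall j : nat, (j < n)%N -> (P - \sum_(z < n) a z *: b z).[q ^ j%:Z] = 0.
  elim: n => [|n IH] ltnN; first by exists (fun=> 0); split=> *; rewrite ?rpred0.
  have [a [Sa Da]] := IH (ltnW ltnN).
  set Q := P - \sum_(z < n) a z *: b z in Da.
  (* The factor cancels the value of ['X^(e n)] at [q ^ n], a unit of [S]. *)
  set c := Q.[q ^ n%:Z] * q ^ (- (n * e n)%:Z).
  have Sc : c \in S.
    rewrite rpredM ?q_power_in // /Q hornerD hornerN horner_sum rpredB //.
    by rewrite rpred_sum // => z _; rewrite hornerZ rpredM //; apply: Sb.
  exists (fun z => if z == n then c else a z); split=> [z|j]; first by case: ifP.
  rewrite big_ord_recr /= eqxx opprD addrA.
  under eq_bigr do rewrite ltn_eqF //.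
  rewrite -/Q hornerD hornerN hornerZ hornerM hornerXn gauss_horner add0r.
  rewrite ltnS leq_eqVlt => /predU1P[->|ltjn].
    rewrite qbin_diag mulr1 /c [_ ^+ e n]exprnP exprz_exp -mulrA -expfzDr //.
    by rewrite PoszM addNr expr0z mulr1 subrr.
  by rewrite Da // qbin_small // !mulr0 subrr.
have [a [Sa Da]] := Newton N (leqnn N).
(* The remainder vanishes at [N] distinct points and has degree below [N]. *)
exists a; split=> //; apply/eqP; rewrite -subr_eq0; apply/eqP.
set Q := P - _; pose rs := [seq q ^ j%:Z | j <- iota 0 N].
apply: (@roots_geq_poly_eq0 _ Q rs).
- by apply/allP => x /mapP[j]; rewrite mem_iota add0n => /Da /= Qj ->; apply/rootP.
- by rewrite (map_inj_uniq q_power_inj) iota_uniq.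
rewrite size_map size_iota; apply: leq_trans (size_polyD _ _) _.
rewrite geq_max szP size_polyN; apply: leq_trans (size_sum _ _ _) _.
apply/bigmax_leqP => z _; apply: leq_trans (size_scale_leq _ _) _.
apply: leq_trans (size_polyMleq _ _) _; rewrite size_polyXn.
by move: (leN z (ltn_ord z)) (size_gauss 0 z); case: (size _) => [|s]; lia.
Qed.

End Gauss.

(** * Laurent polynomials in the group-like elements *)

Lemma horner_algMXaddC (k : fieldType) (U : algType k) (t : U) (P : {poly k}) c :
  horner_alg t (P * 'X + c%:P) = horner_alg t P * t + c%:A.
Proof. by rewrite rmorphD rmorphM /= horner_algX horner_algC. Qed.

Lemma comm_horner_alg (k : fieldType) (U : algType k) (u t : U) (P : {poly k}) :
  GRing.comm u t -> GRing.comm u (horner_alg t P).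
Proof.
move=> ut; elim/poly_ind: P => [|P c IH]; first by rewrite rmorph0; apply: commr0.
rewrite horner_algMXaddC.
by apply: commrD; [apply: commrM | rewrite /GRing.comm mulr_algl mulr_algr].
Qed.

Lemma horner_algZ (k : fieldType) (U : algType k) (t : U) a (P : {poly k}) :
  horner_alg t (a *: P) = a *: horner_alg t P.
Proof. by rewrite -mul_polyC rmorphM /= horner_algC mulr_algl. Qed.

Section Torus.
Variables (k : fieldType) (V : zmodType) (U : unitAlgType k) (K L : V -> U).
Hypotheses (K0 : K 0 = 1) (L0 : L 0 = 1).
Hypothesis KD : forall l m, K l * K m = K (l + m).
Hypothesis LD : forall l m, L l * L m = L (l + m).
Hypothesis KL : forall l m, K l * L m = L m * K l.

Definition tor (l m : V) : U := K l * L m.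

Lemma tor0 : tor 0 0 = 1.
Proof. by rewrite /tor K0 L0 mulr1. Qed.

Lemma torM l m l' m' : tor l m * tor l' m' = tor (l + l') (m + m').
Proof. by rewrite /tor mulrA -[K l * L m * _]mulrA -KL mulrA KD -mulrA LD. Qed.

Lemma tor_comm l m l' m' : GRing.comm (tor l m) (tor l' m').
Proof. by rewrite /GRing.comm !torM addrC [m + _]addrC. Qed.

Lemma tor_exp l m (e : nat) : tor l m ^+ e = tor (l *+ e) (m *+ e).
Proof. by elim: e => [|e IH]; rewrite ?tor0 // exprS IH torM !mulrS. Qed.

Lemma tor_expz l m (e : int) : tor l m ^ e = tor (l *~ e) (m *~ e).
Proof.
case: e => e; first exact: tor_exp.
have torV : tor l m * tor (- l) (- m) = 1 by rewrite torM !subrr tor0.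
have Vtor : tor (- l) (- m) * tor l m = 1 by rewrite torM !addNr tor0.
have -> : tor l m ^ Negz e = tor (- l) (- m) ^+ e.+1.
  rewrite NegzE -exprnN -exprVn; congr (_ ^+ _).
  have Ut : tor l m \is a GRing.unit by apply/unitrP; exists (tor (- l) (- m)).
  by apply: (mulrI Ut); rewrite mulrV.
by rewrite tor_exp NegzE !mulrNz -!pmulrn !mulNrn.
Qed.

(** The element [L v ^ n * T ^ m * P(T)] with [T = K v / L v]; the parameter [n]
    is its degree, both [K v] and [L v] having degree one. *)
Definition laurent (v : V) (n m : int) (P : {poly k}) : U :=
  tor (v *~ m) (v *~ (n - m)) * horner_alg (tor v (- v)) P.

Lemma laurent_comm v n m P v' n' m' P' :
  GRing.comm (laurent v n m P) (laurent v' n' m' P').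
Proof.
apply: commrM; apply/commr_sym; apply: commrM.
- exact: tor_comm.
- by apply: comm_horner_alg; apply: tor_comm.
- by apply/commr_sym/comm_horner_alg; apply: tor_comm.
- by apply: comm_horner_alg; apply/commr_sym/comm_horner_alg; apply: tor_comm.
Qed.

Lemma laurentM v n m P n' m' P' :
  laurent v n m P * laurent v n' m' P' = laurent v (n + n') (m + m') (P * P').
Proof.
rewrite /laurent mulrA -[_ * tor (v *~ m') _]mulrA.
rewrite -(comm_horner_alg P (tor_comm (v *~ m') (v *~ (n' - m')) v (- v))).
rewrite mulrA torM -mulrA rmorphM -!mulrzDr.
by congr (tor (v *~ _) (v *~ _) * _); lia.
Qed.

Lemma laurent0 v : laurent v 0 0 1 = 1.
Proof. by rewrite /laurent subrr !mulr0z tor0 rmorph1 mulr1. Qed.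

Lemma laurentXn v n m (e : nat) P :
  laurent v n m ('X^e * P) = laurent v n (m + e%:Z) P.
Proof.
rewrite /laurent rmorphM rmorphXn /= horner_algX tor_exp mulrA torM.
rewrite !pmulrn mulNrz -mulrNz -!mulrzDr.
by congr (tor (v *~ _) (v *~ _) * _); lia.
Qed.

Lemma laurent_sum v n m (I : Type) (r : seq I) (a : I -> k)
    (F : I -> {poly k}) :
  laurent v n m (\sum_(i <- r) a i *: F i) =
  \sum_(i <- r) a i *: laurent v n m (F i).
Proof.
elim: r => [|i r IH]; first by rewrite !big_nil /laurent rmorph0 mulr0.
by rewrite !big_cons -IH /laurent rmorphD /= horner_algZ mulrDr scalerAr.
Qed.

Lemma qbracket_laurent q v l p :
  qbracket q (K v) (L v) l p = laurent v p 0 (gauss q l p).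
Proof.
rewrite /qbracket /gauss big_add1 /= big_mkord.
elim: p => [|p IH]; first by rewrite !big_ord0 laurent0.
rewrite !big_ord_recr /= IH.
have -> : l - p.+1%:Z + 1 = l - p%:Z by lia.
have -> : p.+1%:Z = p%:Z + 1 by lia.
rewrite -[0 in RHS]addr0 -laurentM; congr (_ * _).
rewrite /laurent subr0 mulr0z mulr1z horner_algZ rmorphB /= horner_algZ horner_algX.
rewrite rmorph1 -scalerAr; congr (_ *: _); rewrite mulrBr mulr1 -scalerAr torM.
by rewrite add0r subrr /tor K0 L0 mulr1 mul1r.
Qed.

Lemma monomial_laurent q v (x : nat) (y : int) (z : nat) :
  K v ^+ x * (K v * L v) ^ y * qbracket q (K v) (L v) 0 z =
  laurent v (x%:Z + 2 * y + z%:Z) (x%:Z + y) (gauss q 0 z).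
Proof.
have -> : K v ^+ x = laurent v x x 1.
  have -> : K v = tor v 0 by rewrite /tor L0 mulr1.
  by rewrite tor_exp /laurent subrr mulr0z mul0rn rmorph1 mulr1.
have -> : (K v * L v) ^ y = laurent v (2 * y) y 1.
  rewrite [LHS]tor_expz /laurent rmorph1 mulr1.
  by congr (tor _ (_ *~ _)); lia.
by rewrite qbracket_laurent !laurentM !mul1r; congr (laurent _ _ _ _); lia.
Qed.

Variable q : k.
Hypothesis q_neq0 : q != 0.
Hypothesis q_nonroot : forall n : nat, (0 < n)%N -> q ^+ n != 1.
Variable S : subringClosed k.
Hypotheses (Sq : q \in S) (SqV : q^-1 \in S).

Definition half_of (w : int) : int := (w %/ 2)%Z.
Definition parity_of (w : int) : bool := (w %% 2)%Z == 1.

Lemma parity_half w : w = (parity_of w)%:Z + 2 * half_of w.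
Proof.
rewrite {1}(divz_eq w 2) mulrC addrC; congr (_ + _).
have := ltz_pmod w (isT : 0 < 2 :> int); have := modz_ge0 w (isT : 2 != 0 :> int).
by rewrite /parity_of; case: eqP => [->|] //=; lia.
Qed.

(** The number of terms may be any large enough [N], so that the expansions for
    finitely many [v] can be given a common length. *)
Lemma laurent_expansion v (n m : int) (P : {poly k}) :
  int_valued q S P ->
  exists N0 : nat, forall N : nat, (N0 <= N)%N ->
  exists a : nat -> k, (forall z, a z \in S) /\
    laurent v n m P = \sum_(z < N) a z *:
      (K v ^+ parity_of (n - z%:Z) * (K v * L v) ^ half_of (n - z%:Z)
       * qbracket q (K v) (L v) 0 z).
Proof.
move=> SP; exists (2 * (`|n| + `|m| + size P) + 4)%N => N leN.
(* [c z] is the lowest exponent of [T] in the [z]-th monomial of degree [n];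
   the highest one is [c z + z]. *)
pose c (z : nat) : int := (parity_of (n - z%:Z))%:Z + half_of (n - z%:Z).
have c2 (z : nat) : n - z%:Z <= 2 * c z <= n - z%:Z + 1.
  rewrite /c; have := parity_half (n - z%:Z).
  by case: (parity_of _) => /= E; apply/andP; split; lia.
(* The last monomial has the widest range; dividing by [T ^ d] turns all of
   them, and the given element, into polynomials in [T]. *)
pose d := c N.-1.
have d_le_m : d <= m by rewrite /d; move: (c2 N.-1) (size P) leN; lia.
have c_ge_d z : (z < N)%N -> (0 <= c z - d) && (c z - d + z%:Z < N%:Z).
  rewrite leq_eqVlt => /predU1P[eqN|ltzN].
    by rewrite /d -eqN /= subrr; lia.
  by rewrite /d; move: (c2 N.-1) (c2 z); lia.
have [|||a [Sa aP]] := @newton_expansion _ q q_neq0 q_nonroot S Sq SqV N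
  (fun z => `|c z - d|%N) ('X^`|m - d|%N * P).
- by apply: int_valuedM => //; apply: int_valuedXn.
- apply: leq_trans (size_polyMleq _ _) _; rewrite size_polyXn.
  by move: (c2 N.-1) (size P) leN; rewrite /d; lia.
- by move=> z /c_ge_d; lia.
exists a; split=> //.
have -> : laurent v n m P = laurent v n d ('X^`|m - d|%N * P).
  by rewrite laurentXn; congr laurent; lia.
rewrite aP laurent_sum; apply: eq_bigr => z _; congr (_ *: _).
rewrite monomial_laurent laurentXn -/(c z); congr laurent.
  by have := parity_half (n - z%:Z); lia.
by have := c_ge_d z (ltn_ord z); lia.
Qed.
End Torus.

(** * Coordinates in the lattice *)

Section Lattice.
Variables (V : zmodType) (theta : nat) (pi : 'I_theta -> V).
Hypothesis pi_basis : is_Zbasis pi.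

Lemma Zbasis_inj (c c' : 'I_theta -> int) :
  \sum_i pi i *~ c i = \sum_i pi i *~ c' i -> c =1 c'.
Proof.
move=> e i; have [d [_ uniq_d]] := pi_basis (\sum_i pi i *~ c i).
have /ffunP/(_ i) : [ffun i => c i] = [ffun i => c' i].
  rewrite -(uniq_d [ffun i => c i]); last by apply: eq_bigr => j _; rewrite ffunE.
  by apply: uniq_d; rewrite e; apply: eq_bigr => j _; rewrite ffunE.
by rewrite !ffunE.
Qed.

Lemma Zbasis_coord : exists co : V -> 'I_theta -> int,
  (forall v, v = \sum_i pi i *~ co v i) /\
  (forall u v i, co (u + v) i = co u i + co v i).
Proof.
have ex v : exists c : {ffun 'I_theta -> int}, v = \sum_i pi i *~ c i.
  by have [c [? _]] := pi_basis v; exists c.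
have [co coE] := choice ex; exists (fun v => co v); split=> // u v.
apply: Zbasis_inj; rewrite -coE {1}(coE u) {1}(coE v) -big_split.
by apply: eq_bigr => i _; rewrite mulrzDr.
Qed.

Lemma Zbasis_character (k : fieldType) (t : 'I_theta -> k) :
  (forall i, t i != 0) ->
  exists ev : V -> k,
    [/\ ev 0 = 1, forall u v, ev (u + v) = ev u * ev v & forall i, ev (pi i) = t i].
Proof.
move=> t0; have [co [coE coD]] := Zbasis_coord.
exists (fun v => \prod_i t i ^ co v i); split=> [|u v|i].
- apply: big1 => i _; have := coD 0 0 i; rewrite addr0 => e.
  by have -> : co 0 i = 0 by lia.
- by rewrite -big_split; apply: eq_bigr => i _; rewrite coD expfzDr.
have co_pi : co (pi i) =1 fun j => (j == i)%:Z.
  apply: Zbasis_inj; rewrite -coE (bigD1 i) //= eqxx mulr1z big1 ?addr0 // => j.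
  by move=> /negbTE->; rewrite mulr0z.
rewrite (bigD1 i) //= co_pi eqxx expr1z big1 ?mulr1 // => j ji.
by rewrite co_pi (negbTE ji) expr0z.
Qed.

End Lattice.

(** * Evaluating homogeneous elements at characters *)

Section Evaluation.
Variables (k : fieldType) (V : zmodType) (U : unitAlgType k) (K L : V -> U).
Hypotheses (K0 : K 0 = 1) (L0 : L 0 = 1).
Hypothesis KD : forall l m, K l * K m = K (l + m).
Hypothesis LD : forall l m, L l * L m = L (l + m).
Hypothesis KL : forall l m, K l * L m = L m * K l.
Variable ev : V -> k.
Hypotheses (ev0 : ev 0 = 1) (evD : forall u v, ev (u + v) = ev u * ev v).

Lemma ev_mulrz v (m : int) : ev (v *~ m) = ev v ^ m.
Proof.
have evMn u (e : nat) : ev (u *+ e) = ev u ^+ e.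
  by elim: e => [|e IH]; rewrite ?mulr0n // mulrS evD IH exprS.
have evN u : ev (- u) = (ev u)^-1.
  have evV : ev (- u) * ev u = 1 by rewrite -evD addNr ev0.
  have u0 : ev u != 0.
    by apply/eqP => e; move: evV; rewrite e mulr0 => /esym/eqP; rewrite oner_eq0.
  by apply: (mulIf u0); rewrite evV mulVf.
case: m => e; first exact: evMn.
by rewrite NegzE mulrNz -exprnN evN -pmulrn evMn.
Qed.

(** [u] is a combination of the products [K l * L (n - l)], thus homogeneous of
    degree [n], and [a] is its image under the linear map that sends
    [K l * L (n - l)] to [ev l]. A relation avoids choosing an expression for
    [u]; that [a] is determined by [u] follows from [homog_value_relation]. *)
Definition homog_value (n : V) (u : U) (a : k) : Prop :=
  exists r : seq (k * V),
    u = \sum_(t <- r) t.1 *: tor K L t.2 (n - t.2) /\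
    a = \sum_(t <- r) t.1 * ev t.2.

Lemma homog_value_tor l m : homog_value (l + m) (tor K L l m) (ev l).
Proof.
by exists [:: (1, l)]; rewrite !big_seq1 /= scale1r mul1r addrAC subrr add0r.
Qed.

Lemma homog_value1 : homog_value 0 1 1.
Proof. by have := homog_value_tor 0 0; rewrite addr0 ev0 tor0. Qed.

Lemma homog_valueD n u a v b :
  homog_value n u a -> homog_value n v b -> homog_value n (u + v) (a + b).
Proof.
by move=> [r [-> ->]] [r' [-> ->]]; exists (r ++ r'); rewrite !big_cat.
Qed.

Lemma homog_valueZ n c u a :
  homog_value n u a -> homog_value n (c *: u) (c * a).
Proof.
move=> [r [-> ->]]; exists [seq (c * t.1, t.2) | t <- r].
rewrite !big_map scaler_sumr mulr_sumr.
by split; apply: eq_bigr => t _; rewrite ?scalerA ?mulrA.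
Qed.

Lemma homog_valueM n u a m v b :
  homog_value n u a -> homog_value m v b -> homog_value (n + m) (u * v) (a * b).
Proof.
move=> [r [-> ->]] [r' [-> ->]].
exists [seq (t.1 * t'.1, t.2 + t'.2) | t <- r, t' <- r'].
rewrite !big_allpairs_dep !mulr_suml.
split; apply: eq_bigr => t _; rewrite mulr_sumr; apply: eq_bigr => t' _ /=.
  rewrite -scalerAl -scalerAr scalerA torM //; congr (_ *: tor _ _ _ _).
  by rewrite opprD addrACA.
by rewrite evD mulrACA.
Qed.

Lemma homog_value_horner v P :
  homog_value 0 (horner_alg (tor K L v (- v)) P) P.[ev v].
Proof.
elim/poly_ind: P => [|P c IH].
  by rewrite rmorph0 horner0; exists [::]; rewrite !big_nil.
rewrite horner_algMXaddC hornerMXaddC.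
apply: homog_valueD; last first.
  by have := homog_valueZ c homog_value1; rewrite mulr1.
rewrite -[0]addr0; apply: homog_valueM => //.
by have := homog_value_tor v (- v); rewrite subrr.
Qed.

Lemma homog_value_laurent v n m P :
  homog_value (v *~ n) (laurent K L v n m P) (ev v ^ m * P.[ev v]).
Proof.
rewrite -[v *~ n]addr0 -ev_mulrz; apply: homog_valueM (homog_value_horner _ _).
have -> : v *~ n = v *~ m + v *~ (n - m) by rewrite -mulrzDr subrKC.
exact: homog_value_tor.
Qed.

Lemma homog_value_prod (I : Type) (r : seq I) (n : I -> V) (u : I -> U)
    (a : I -> k) :
  (forall i, homog_value (n i) (u i) (a i)) ->
  homog_value (\sum_(i <- r) n i) (\prod_(i <- r) u i) (\prod_(i <- r) a i).
Proof.
move=> uP; elim: r => [|i r IH]; rewrite ?big_nil ?big_cons.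
  exact: homog_value1.
exact: homog_valueM.
Qed.

(** Extracting one homogeneous component of a relation and evaluating it is the
    linear form which is [ev l] on [K l * L m] if [l + m = n0] and zero
    otherwise. *)
Lemma homog_value_relation (J : eqType) (s : seq J) (c : J -> k) (n : J -> V)
    (u : J -> U) (a : J -> k) :
  free_over setT (fun lm : V * V => K lm.1 * L lm.2) ->
  (forall j, homog_value (n j) (u j) (a j)) ->
  \sum_(j <- s) c j *: u j = 0 ->
  forall n0, \sum_(j <- s | n j == n0) c j * a j = 0.
Proof.
move=> KL_free uP s0 n0; have [r rP] := choice uP.
pose R := [seq (c j * t.1, (t.2, n j - t.2)) | j <- s, t <- r j].
have := free_over_functional (fun lm => if lm.1 + lm.2 == n0 then ev lm.1 else 0)
  (r := R) KL_free.
rewrite !big_allpairs_dep /= => H; rewrite -[RHS]H; last first.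
  rewrite -[RHS]s0; apply: eq_bigr => j _; rewrite (rP j).1 scaler_sumr.
  by apply: eq_bigr => t _; rewrite scalerA.
rewrite big_mkcond; apply: eq_bigr => j _; rewrite (rP j).2.
case: ifP => e.
  by rewrite mulr_sumr; apply: eq_bigr => t _; rewrite subrKC e mulrA.
by rewrite big1 // => t _; rewrite subrKC e mulr0.
Qed.

End Evaluation.

(** * The integral form and its monomial basis *)

Lemma subalg_gen_subalg (k : nzRingType) (U : algType k) (scalars : set k)
    (G : set U) : subalg_over scalars (subalg_gen scalars G).
Proof.
split=> [B [[]] //|a u v Sa Gu Gv B BG|u v Gu Gv B BG].
  by have [[_ Blin _] _] := BG; apply: Blin => //; [apply: Gu | apply: Gv].
by have [[_ _ Bmul] _] := BG; apply: Bmul; [apply: Gu | apply: Gv].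
Qed.

Lemma subring_gen_closed (k : nzRingType) (G : set k) :
  subring_closed [in subring_gen G].
Proof.
split=> [|x y|x y]; rewrite ?inE /=.
- by move=> B [[B1 _ _] _]; have := B1; rewrite inE.
- move=> Gx Gy B BG; have [[_ BB _] _] := BG.
  by have := BB x y; rewrite !inE; apply; [apply: Gx | apply: Gy].
move=> Gx Gy B BG; have [[_ _ BB] _] := BG.
by have := BB x y; rewrite !inE; apply; [apply: Gx | apply: Gy].
Qed.

Section ZeroPart.
Variables (k : fieldType) (V : zmodType) (theta : nat) (pi : 'I_theta -> V).
Hypothesis pi_basis : is_Zbasis pi.
Variables (chi : V -> V -> k) (S : subringClosed k).
Local Notation q i := (chi (pi i) (pi i)).
Hypotheses (q_neq0 : forall i, q i != 0)
  (q_nonroot : forall i n, (0 < n)%N -> q i ^+ n != 1)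
  (Sq : forall i, q i \in S) (SqV : forall i, (q i)^-1 \in S).
Variables (U : unitAlgType k) (K L : V -> U).
Hypotheses (K0 : K 0 = 1) (L0 : L 0 = 1)
  (KD : forall l m, K l * K m = K (l + m))
  (LD : forall l m, L l * L m = L (l + m))
  (KL : forall l m, K l * L m = L m * K l).

Local Notation mon := (zero_monomial pi chi K L).
Local Notation index := ({ffun 'I_theta -> bool} * {ffun 'I_theta -> int} *
  {ffun 'I_theta -> nat})%type.

(** A multiplicatively closed set that contains the monomials and the generators
    of the integral form, and lies in the span of the monomials. *)
Definition integral_product (u : U) : Prop :=
  exists (n m : 'I_theta -> int) (P : 'I_theta -> {poly k}),
    (forall i, int_valued (q i) S (P i)) /\
    u = \prod_i laurent K L (pi i) (n i) (m i) (P i).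

Lemma integral_productM u v :
  integral_product u -> integral_product v -> integral_product (u * v).
Proof.
move=> [n [m [P [SP ->]]]] [n' [m' [P' [SP' ->]]]].
exists (fun i => n i + n' i), (fun i => m i + m' i), (fun i => P i * P' i).
split=> [i|]; first exact: int_valuedM.
rewrite -prodrM_comm => [|i j _ _]; last exact: laurent_comm.
by apply: eq_bigr => i _; rewrite laurentM.
Qed.

Lemma zero_monomial_laurent x y z :
  mon (x, y, z) = \prod_i laurent K L (pi i) ((x i)%:Z + 2 * y i + (z i)%:Z)
                    ((x i)%:Z + y i) (gauss (q i) 0 (z i)).
Proof. by apply: eq_bigr => i _; rewrite monomial_laurent. Qed.

Lemma zero_monomial_integral xyz : integral_product (mon xyz).
Proof.
case: xyz => [[x y] z]; rewrite zero_monomial_laurent.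
exists (fun i => (x i)%:Z + 2 * y i + (z i)%:Z), (fun i => (x i)%:Z + y i),
  (fun i => gauss (q i) 0 (z i)); split=> // i.
by apply: int_valued_gauss => // ?; apply: q_nonroot.
Qed.

(** Expanding every factor and distributing the product over the sums. *)
Lemma integral_product_span u :
  integral_product u -> span_over [set` S] mon u.
Proof.
move=> [n [m [P [SP ->]]]].
have [N0 N0P] := choice (fun i => laurent_expansion K0 L0 KD LD KL (q_neq0 i)
  (@q_nonroot i) (Sq i) (SqV i) (pi i) (n i) (m i) (SP i)).
pose N := \max_i N0 i.
have [a aP] := choice (fun i => N0P i N (leq_bigmax i)).
under eq_bigr do rewrite (aP _).2.
rewrite bigA_distr_bigA /=.
under eq_bigr do rewrite scaler_prod.
apply: span_over_sum => f _.
  by apply: rpred_prod => i _; apply: (aP i).1.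
have <- : mon ([ffun i => parity_of (n i - (f i : nat)%:Z)],
     [ffun i => half_of (n i - (f i : nat)%:Z)], [ffun i => f i : nat]) =
  \prod_i (K (pi i) ^+ parity_of (n i - (f i : nat)%:Z) *
    (K (pi i) * L (pi i)) ^ half_of (n i - (f i : nat)%:Z) *
    qbracket (q i) (K (pi i)) (L (pi i)) 0 (f i)).
  by apply: eq_bigr => i _; rewrite !ffunE.
exact: span_over_basis.
Qed.

Lemma span_zero_monomialM u v :
  span_over [set` S] mon u -> span_over [set` S] mon v ->
  span_over [set` S] mon (u * v).
Proof.
move=> [s [c [Sc ->]]] [s' [c' [Sc' ->]]].
rewrite mulr_suml; under eq_bigr do rewrite -scalerAl mulr_sumr.
apply: span_over_sum => j _; first exact: Sc.
under eq_bigr do rewrite -scalerAr.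
apply: span_over_sum => j' _; first exact: Sc'.
by apply/integral_product_span/integral_productM; apply: zero_monomial_integral.
Qed.

Lemma integral_product1 : integral_product 1.
Proof.
exists (fun=> 0), (fun=> 0), (fun=> 1); split=> [i|]; first exact: int_valued1.
by rewrite big1 // => i _; apply: laurent0.
Qed.

Lemma tor_integral l m : integral_product (K l * L m).
Proof.
have [co [coE _]] := Zbasis_coord pi_basis.
exists (fun i => co l i + co m i), (co l), (fun=> 1); split=> [i|].
  exact: int_valued1.
under eq_bigr do rewrite /laurent rmorph1 mulr1 addrAC subrr add0r.
rewrite -/(tor K L l m) {1}(coE l) {1}(coE m).
elim: (index_enum _) => [|i r IH]; rewrite ?big_nil ?tor0 // !big_cons -IH.
by rewrite torM.
Qed.

Lemma qbracket_integral i l p :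
  integral_product (qbracket (q i) (K (pi i)) (L (pi i)) l p).
Proof.
exists (fun j => if j == i then p%:Z else 0), (fun=> 0),
  (fun j => if j == i then gauss (q i) l p else 1); split=> [j|].
  case: eqP => [->|_]; last exact: int_valued1.
  by apply: int_valued_gauss => // ?; apply: q_nonroot.
(* The ring is not commutative, so the single nontrivial factor is isolated by
   filtering the product instead of moving it to the front. *)
set b := qbracket _ _ _ _ _; have <- : \prod_(j | j == i) b = b.
  exact: big_pred1_eq.
rewrite big_mkcond; apply: eq_bigr => j _ /=.
by case: eqP => [->|_]; rewrite /b ?qbracket_laurent ?laurent0.
Qed.

Local Notation form := (subalg_gen [set` S]
    ([set u | exists l m, u = K l * L m] `|`
     [set u | exists i (l : int) (p : nat),
        u = qbracket (q i) (K (pi i)) (L (pi i)) l p])%classic).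

Lemma U_zero_form_eq_span : form = span_over [set` S] mon.
Proof.
apply/seteqP; split=> u.
  apply; split; last first.
    move=> _ [[l [m ->]]|[i [l [p ->]]]]; apply: integral_product_span.
      exact: tor_integral.
    exact: qbracket_integral.
  split; [|exact: span_over_linear|exact: span_zero_monomialM].
  exact/integral_product_span/integral_product1.
have [f1 flin fmul] := subalg_gen_subalg [set` S]
    ([set u | exists l m, u = K l * L m] `|`
     [set u | exists i (l : int) (p : nat),
        u = qbracket (q i) (K (pi i)) (L (pi i)) l p])%classic.
have f_tor l m : form (K l * L m) by move=> B [_]; apply; left; exists l, m.
have f_mon j : form (mon j).
  case: j => [[x y] z]; apply: (big_rec form) => // i w _; apply: (fmul).
  apply: (fmul); last by move=> B [_]; apply; right; exists i, 0, (z i).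
  apply: (fmul).
    have -> : K (pi i) = tor K L (pi i) 0 by rewrite /tor L0 mulr1.
    by rewrite tor_exp //; apply: f_tor.
  by rewrite -/(tor K L _ _) tor_expz //; apply: f_tor.
move=> [s [c [Sc ->]]]; elim: s => [|j s IH]; last first.
  by rewrite big_cons; apply: flin.
rewrite big_nil -(subrr (1 : U)) -scaleN1r addrC; apply: flin => //=.
by rewrite rpredN1.
Qed.

(** Induction on [w], the sum of the exponents [z i]: when the relation is
    evaluated at the character attached to [z], a term of the same degree with
    some [z' i > z i] vanishes, and one with [z' <= z] has smaller [w] unless
    [z' = z], in which case the degree forces equality. *)
Lemma zero_monomial_free :
  free_over setT (fun lm : V * V => K lm.1 * L lm.2) ->
  free_over [set` S] mon.
Proof.
move=> KL_free s c uniq_s _ s0.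
pose w (j : index) := (\sum_i j.2 i)%N.
suff H n : forall j, j \in s -> w j = n -> c j = 0 by move=> j js; apply: H js erefl.
elim/ltn_ind: n => n IH [[x y] z] js wn.
have [ev [ev0 evD ev_pi]] := @Zbasis_character _ _ _ pi_basis k
  (fun i => q i ^ (z i)%:Z) (fun i => expfz_neq0 _ (q_neq0 i)).
pose deg (j : index) (i : 'I_theta) :=
  (j.1.1 i)%:Z + 2 * j.1.2 i + (j.2 i)%:Z.
pose val (j : index) : k :=
  \prod_i ((q i ^ (z i)%:Z) ^ ((j.1.1 i)%:Z + j.1.2 i)
                      * qbin (q i) (z i)%:Z (j.2 i)).
have mon_value j : homog_value K L ev (\sum_i pi i *~ deg j i) (mon j) (val j).
  case: j => [[x' y'] z']; rewrite zero_monomial_laurent.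
  apply: homog_value_prod => // i; rewrite -ev_pi -[in qbin _ _ _](add0r (z i)%:Z).
  by rewrite -gauss_horner // -ev_pi; apply: homog_value_laurent.
have := homog_value_relation KL_free mon_value s0 (\sum_i pi i *~ deg (x, y, z) i).
rewrite big_mkcond (bigD1_seq _ js uniq_s) /= eqxx.
rewrite big_seq_cond big1 ?addr0 => [|j' /andP[j's j'j]].
  move/eqP; rewrite mulf_eq0 => /orP[/eqP //|].
  rewrite prodf_seq_eq0 => /hasP[i _] /=.
  by rewrite (qbin_diag (q_neq0 i) (@q_nonroot i)) mulr1
    !expfz_eq0 (negbTE (q_neq0 i)) !andbF.
case: eqP => // /(Zbasis_inj pi_basis) deg_eq.
have [lt_w|le_w] := ltnP (w j') n; first by rewrite (IH _ lt_w) ?mul0r.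
have [/existsP[i lt_z]|/existsPn ge_z] := boolP [exists i, z i < j'.2 i]%N.
  by rewrite /val (bigD1 i) //= qbin_small // mulr0 mul0r mulr0.
case/eqP: j'j; case: j' j's deg_eq le_w ge_z => [[x' y'] z'] _ deg_eq le_w ge_z.
have le_z i : (z' i <= z i)%N by have := ge_z i; rewrite /= -leqNgt.
have z_eq i : z' i = z i.
  have sum_eq := leqif_sum (fun i (_ : true) => leqif_eq (le_z i)).
  have : (\sum_i z' i == \sum_i z i)%N.
    by rewrite eqn_leq sum_eq /=; move: le_w; rewrite -wn.
  by rewrite sum_eq => /forallP/(_ i)/eqP.
have xy_eq i : x' i = x i /\ y' i = y i.
  by have := deg_eq i; rewrite /deg /= z_eq; case: (x i); case: (x' i) => /=; lia.
congr (_, _, _); apply/ffunP => i; rewrite ?z_eq //; apply xy_eq.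
Qed.

End ZeroPart.

(** * The theorem *)

Definition in_subring_gen (k : nzRingType) (G : set k) : {pred k} :=
  [in subring_gen G].

HB.instance Definition _ (k : nzRingType) (G : set k) :=
  GRing.isSubringClosed.Build k (in_subring_gen G) (subring_gen_closed G).

Lemma subring_genE (k : nzRingType) (G : set k) :
  subring_gen G = [set` in_subring_gen G]%classic.
Proof. by apply/seteqP; split=> x; rewrite /= inE. Qed.

Lemma subring_gen_mem (k : nzRingType) (G : set k) x : G x -> x \in in_subring_gen G.
Proof. by move=> Gx; rewrite inE => B [_]; apply. Qed.

Theorem lemma3p3 (R : realType) (k : fieldType) (char0 : [pchar k] =i pred0)
    (V : zmodType) (theta : nat) (theta_gt0 : (0 < theta)%N)
    (pi : 'I_theta -> V) (pi_basis : is_Zbasis pi)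
    (A : 'M[int]_theta) (A_simple : simple_lie_cartan_matrix R[i] A)
    (d : 'I_theta -> nat) (qdot : k) (sqrtchi chi : V -> V -> k)
    (chi_adm : admissible pi A d qdot sqrtchi chi)
    (U : unitAlgType k) (K L : V -> U) (E F : 'I_theta -> U)
    (U_gqg : is_gen_quantum_group pi chi K L E F) :
  basis_over (ground_form pi sqrtchi) (U_zero_form pi sqrtchi chi K L)
    (zero_monomial pi chi K L).
Proof.
have [_ KL_free] := gqg_zero_basis U_gqg.
have [_ _ _ d_gt0 _] := adm_gcm chi_adm.
(* [chi] is the square of [sqrtchi], whose value here is [qdot ^+ (2 * d i)]. *)
have qE i : chi (pi i) (pi i) = qdot ^+ (4 * d i).
  by rewrite (adm_square chi_adm) (adm_diag chi_adm) -exprM; congr (_ ^+ _); lia.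
rewrite /basis_over /U_zero_form /ground_form subring_genE.
set S := in_subring_gen _.
have q_neq0 i : chi (pi i) (pi i) != 0.
  by rewrite qE expf_neq0 // (adm_qdot_neq0 chi_adm).
have q_nonroot i n : (0 < n)%N -> chi (pi i) (pi i) ^+ n != 1.
  by move=> n0; rewrite qE -exprM (adm_qdot_nonroot chi_adm) // !muln_gt0 d_gt0.
have Sq i : chi (pi i) (pi i) \in S.
  rewrite (adm_square chi_adm) rpredX // subring_gen_mem //.
  by exists i, i; left.
have SqV i : (chi (pi i) (pi i))^-1 \in S.
  rewrite (adm_square chi_adm) -exprVn rpredX // subring_gen_mem //.
  by exists i, i; right.
have [K0 L0] := (gqg_K0 U_gqg, gqg_L0 U_gqg).
have [[KD LD] KL] := (gqg_KD U_gqg, gqg_LD U_gqg, gqg_KL U_gqg).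
split; first by apply: U_zero_form_eq_span.
by apply: zero_monomial_free.
Qed.
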